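(* Let $n\ge1$ and $\alpha\in(0,1)$. The linear space $BV^\alpha(\mathbb R^n)$ equipped with the norm $$\|f\|_{BV^\alpha(\mathbb R^n)}:=\|f\|_{L^1(\mathbb R^n)}+|D^\alpha f|(\mathbb R^n),\qquad f\in BV^\alpha(\mathbb R^n),$$ is a Banach space.
   Context: For $\alpha\in(0,1)$ let $\mu_{n,\alpha}:=2^\alpha\pi^{-n/2}\,\Gamma\big(\tfrac{n+\alpha+1}{2}\big)/\Gamma\big(\tfrac{1-\alpha}{2}\big)$. For $\varphi\in C^\infty_c(\mathbb R^n;\mathbb R^n)$ the fractional $\alpha$-divergence is $$\mathrm{div}^\alpha\varphi(x):=\mu_{n,\alpha}\int_{\mathbb R^n}\frac{(y-x)\cdot(\varphi(y)-\varphi(x))}{|y-x|^{n+\alpha+1}}\,dy,$$ which is a function in $L^1(\mathbb R^n)\cap L^\infty(\mathbb R^n)$. For $f\in L^1(\mathbb R^n)$ the fractional variation is $$|D^\alpha f|(\mathbb R^n):=\sup\Big\{\int_{\mathbb R^n}f\,\mathrm{div}^\alpha\varphi\,dx:\ \varphi\in C^\infty_c(\mathbb R^n;\mathbb R^n),\ \|\varphi\|_{L^\infty(\mathbb R^n;\mathbb R^n)}\le1\Big\}.$$ The space $BV^\alpha(\mathbb R^n)$ consists of all $f\in L^1(\mathbb R^n)$ with $|D^\alpha f|(\mathbb R^n)<+\infty$. *)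

(* Defs.v *)
From HB Require Import structures.
From mathcomp Require Import all_boot all_order all_algebra.
From mathcomp Require Import all_classical all_reals all_analysis.

Set Implicit Arguments.
Unset Strict Implicit.
Unset Printing Implicit Defensive.

Import Order.TTheory GRing.Theory Num.Theory.
Import numFieldNormedType.Exports.

Local Open Scope classical_set_scope.
Local Open Scope ring_scope.

(* R^n is 'rV[R]_n, with the product sigma-algebra (as the library does for
   n.-tuple); it is the Borel sigma-algebra of the topology of 'rV[R]_n. *)
Section measurable_rV.
Context {R : realType} {n : nat}.

Let coors (i : 'I_n) (x : 'rV[R]_n) : measurableTypeR R := x ord0 i.

Let rV_set0 : g_sigma_preimage coors set0.
Proof. exact: sigma_algebra0. Qed.

Let rV_setC A : g_sigma_preimage coors A -> g_sigma_preimage coors (~` A).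
Proof. exact: sigma_algebraC. Qed.

Let rV_bigcup (F : _^nat) : (forall i, g_sigma_preimage coors (F i)) ->
  g_sigma_preimage coors (\bigcup_i (F i)).
Proof. exact: sigma_algebra_bigcup. Qed.

HB.instance Definition _ := @isMeasurable.Build default_measure_display
  'rV[R]_n (g_sigma_preimage coors) rV_set0 rV_setC rV_bigcup.

Lemma measurable_rV_coord (i : 'I_n) :
  measurable_fun [set: 'rV[R]_n]
    (fun x : 'rV[R]_n => x ord0 i : measurableTypeR R).
Proof.
move=> _ Y mY; rewrite setTI; apply: sub_sigma_algebra => /=.
rewrite -bigcup_seq/=; exists i => /=; first by rewrite mem_index_enum.
by exists Y => //; rewrite setTI.
Qed.

Lemma measurable_fun_rV d (T : measurableType d) (f : T -> 'rV[R]_n) :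
  (forall i,
    measurable_fun [set: T] (fun x => f x ord0 i : measurableTypeR R)) ->
  measurable_fun [set: T] f.
Proof.
move=> mf _ A mA.
suff: g_sigma_preimage (fun i => coors i \o f) `<=` measurable.
  apply; rewrite g_sigma_preimage_comp; exact: (ex_intro2 _ _ A).
apply: smallest_sub; first exact: sigma_algebra_measurable.
by rewrite -bigcup_seq/=; apply: bigcup_sub => i _ B [C mC <-]; exact: mf.
Qed.

End measurable_rV.

Section rV_cons.
Context {R : realType} {n : nat}.

Definition rV_cons (p : measurableTypeR R * 'rV[R]_n) : 'rV[R]_n.+1 :=
  row_mx (p.1 : R)%:M p.2 : 'rV[R]_(1 + n).

Definition rV_uncons (x : 'rV[R]_n.+1) : measurableTypeR R * 'rV[R]_n :=
  (x ord0 ord0, rsubmx (x : 'rV[R]_(1 + n))).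

Lemma rV_consK : cancel rV_cons rV_uncons.
Proof.
move=> [a x]; rewrite /rV_uncons /rV_cons row_mxKr; congr pair.
transitivity (row_mx (a : R)%:M x (ord0 : 'I_1) (lshift n ord0)).
  by congr (row_mx _ _ _ _); exact: val_inj.
by rewrite row_mxEl mxE eqxx.
Qed.

Lemma measurable_rV_cons : measurable_fun [set: _] rV_cons.
Proof.
apply: measurable_fun_rV => i.
have [j ->|j ->] := split_ordP (i : 'I_(1 + n)).
  rewrite (_ : (fun _ => _) = fst); first exact: measurable_fst.
  apply/funext => p; apply: etrans (row_mxEl _ _ _ _) _.
  by rewrite mxE (ord1 j).
rewrite (_ : (fun _ => _) = (fun x : 'rV[R]_n => x ord0 j) \o snd).
  by apply: measurableT_comp; [exact: measurable_rV_coord|exact: measurable_snd].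
by apply/funext => p; exact: (row_mxEr (p.1 : R)%:M).
Qed.

HB.instance Definition _ := isMeasurableFun.Build _ _ _ _ rV_cons
  measurable_rV_cons.

Lemma measurable_rV_uncons : measurable_fun [set: 'rV[R]_n.+1] rV_uncons.
Proof.
apply/measurable_fun_pairP; split; first exact: measurable_rV_coord.
apply: measurable_fun_rV => i /=.
under eq_fun do rewrite mxE.
exact: measurable_rV_coord.
Qed.

Variable m : {sigma_finite_measure set 'rV[R]_n -> \bar R}.

Definition rV_cons_measure : set 'rV[R]_n.+1 -> \bar R :=
  pushforward (@lebesgue_measure R \x m)%E rV_cons.

Let rV_cons_measure0 : rV_cons_measure set0 = 0%E.
Proof. exact: measure0. Qed.

Let rV_cons_measure_ge0 A : (0 <= rV_cons_measure A)%E.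
Proof. exact: measure_ge0. Qed.

Let rV_cons_measure_sigma_additive : semi_sigma_additive rV_cons_measure.
Proof. exact: measure_semi_sigma_additive. Qed.

HB.instance Definition _ := isMeasure.Build _ _ _ rV_cons_measure
  rV_cons_measure0 rV_cons_measure_ge0 rV_cons_measure_sigma_additive.

Let rV_cons_measure_sigma_finite : sigma_finite setT rV_cons_measure.
Proof.
have /sigma_finiteP[F [TF ndF Foo]] := sigma_finiteT (@lebesgue_measure R).
have /sigma_finiteP[G [TG ndG Goo]] := sigma_finiteT m.
exists (fun k => rV_uncons @^-1` (F k `*` G k)).
  apply/esym/seteqP; split => // x _.
  have [i _ Fi] : (\bigcup_i F i) (rV_uncons x).1 by rewrite -TF.
  have [j _ Gj] : (\bigcup_i G i) (rV_uncons x).2 by rewrite -TG.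
  exists (maxn i j) => //; split.
    by move: Fi; exact/subsetPset/ndF/leq_maxl.
  by move: Gj; exact/subsetPset/ndG/leq_maxr.
move=> k; have [mF Fk] := Foo k; have [mG Gk] := Goo k.
have mFG := measurableX mF mG.
split.
  by rewrite -[X in measurable X]setTI; exact: measurable_rV_uncons.
rewrite /rV_cons_measure /pushforward -comp_preimage.
rewrite (_ : _ \o _ = id); last by apply/funext => p /=; exact: rV_consK.
rewrite preimage_id product_measure1E//.
by rewrite lte_mul_pinfty// ge0_fin_numE.
Qed.

HB.instance Definition _ := Measure_isSigmaFinite.Build _ _ _
  rV_cons_measure rV_cons_measure_sigma_finite.

End rV_cons.

(* The n-fold product of the Lebesgue measure on R. *)
Fixpoint lebesgue_rV (R : realType) (n : nat) :
    {sigma_finite_measure set 'rV[R]_n -> \bar R} :=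
  if n is k.+1 then rV_cons_measure (lebesgue_rV R k)
  else \d_ (0 : 'rV[R]_0).

Section fractional_variation.
Context {R : realType}.

Definition Gamma (s : R) : R :=
  \int[@lebesgue_measure R]_(t in `]0, +oo[) (t `^ (s - 1) * expR (- t)).

Fixpoint Ck {V W : normedModType R} (k : nat) (f : V -> W) : Prop :=
  if k is k'.+1 then
    (forall x, differentiable f x) /\ forall v, Ck k' ('D_v f)
  else continuous f.

Definition smooth {V W : normedModType R} (f : V -> W) : Prop :=
  forall k, Ck k f.

Definition compactly_supported {V W : normedModType R} (f : V -> W) : Prop :=
  compact (closure [set x | f x != 0]).

Definition dotv {n : nat} (x y : 'rV[R]_n) : R :=
  \sum_(i < n) x ord0 i * y ord0 i.

(* `|x| on 'rV[R]_n is the sup norm, hence a separate Euclidean norm. *)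
Definition enorm {n : nat} (x : 'rV[R]_n) : R := Num.sqrt (dotv x x).

Definition mu_frac (n : nat) (alpha : R) : R :=
  2 `^ alpha * pi `^ (- (n%:R / 2)) *
  (Gamma ((n%:R + alpha + 1) / 2) / Gamma ((1 - alpha) / 2)).

Context {n : nat}.

(* The integrand is 0 at y = x, because x / 0 = 0. *)
Definition frac_div (alpha : R) (phi : 'rV[R]_n -> 'rV[R]_n) (x : 'rV[R]_n) :
    R :=
  mu_frac n alpha *
  \int[lebesgue_rV R n]_y
    (dotv (y - x) (phi y - phi x) / enorm (y - x) `^ (n%:R + alpha + 1)).

Definition frac_test (phi : 'rV[R]_n -> 'rV[R]_n) : Prop :=
  [/\ smooth phi, compactly_supported phi &
      ('N[lebesgue_rV R n]_+oo[EFin \o enorm \o phi] <= 1)%E].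

Definition frac_variation (alpha : R) (f : 'rV[R]_n -> R) : \bar R :=
  ereal_sup [set (\int[lebesgue_rV R n]_x (f x * frac_div alpha phi x)%:E)%E
            | phi in frac_test].

End fractional_variation.

(* Elements of LspaceType1 are a.e. classes; used as a function, a class stands
   for a chosen representative, which affects neither integrals nor norms. *)
Definition BV_frac (R : realType) (n : nat) (alpha : R) : Type :=
  {f : LspaceType1 (lebesgue_rV R n) | (frac_variation alpha f < +oo)%E}.

Definition BV_frac_fun (R : realType) (n : nat) (alpha : R)
  (f : BV_frac n alpha) : 'rV[R]_n -> R := sval f.
Coercion BV_frac_fun : BV_frac >-> Funclass.

Definition BV_frac_norm (R : realType) (n : nat) (alpha : R)
    (f : BV_frac n alpha) : \bar R :=
  ('N[lebesgue_rV R n]_1[EFin \o f] + frac_variation alpha f)%E.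

(* Main.v *)
(* The fractional variation is a supremum of the linear functionals
   f |-> int f div^alpha phi.  Each div^alpha phi is measurable and bounded, so
   each functional is continuous on L^1 and the supremum is a lower
   semicontinuous extended seminorm (the tests are nonempty and symmetric).  A
   Cauchy sequence for the BV^alpha norm converges in L^1, and lower
   semicontinuity turns this into convergence for the BV^alpha norm.

   Boundedness of div^alpha phi: since phi is bounded and Lipschitz, with
   r = |y - x| the kernel is at most a multiple of both r^(1-alpha) / r^n and
   r^(-alpha) / r^n.  On a dyadic shell r ~ 2^-k (resp. r ~ 2^k) the factor
   1 / r^n is compensated by the volume of the ball of radius r, so both ends
   are controlled by geometric series that do not depend on x. *)
Require Import Defs.
From HB Require Import structures.
From mathcomp Require Import all_boot all_order all_algebra.
From mathcomp Require Import all_classical all_reals all_analysis.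
From mathcomp Require Import measurable_realfun.
From mathcomp Require Import ring lra.

Set Implicit Arguments.
Unset Strict Implicit.
Unset Printing Implicit Defensive.

Import Order.TTheory GRing.Theory Num.Theory.
Import numFieldNormedType.Exports.

Local Open Scope classical_set_scope.
Local Open Scope ring_scope.

(** * Geometric sequences and rapidly converging sequences *)

Lemma exprn_small (R : realType) (q e : R) : 0 <= q < 1 -> 0 < e ->
  exists k, q ^+ k < e.
Proof.
move=> /andP[q0 q1] e0.
have : geometric 1 q n @[n --> \oo] --> 0.
  by apply: cvg_geometric; rewrite ger0_norm.
move/cvgrPdist_lt => /(_ _ e0)[k _ /(_ k (leqnn _))].
rewrite /geometric /= mul1r sub0r normrN ger0_norm ?exprn_ge0// => ?; by exists k.
Qed.

(** A Cauchy filter contains a small ball around some [x k] for every k. Points picked in the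
    intersections of these balls form a rapid sequence, and the filter converges to its limit. *)
Lemma rapid_complete (R : realType) (V : normedModType R) :
  (forall u : V^nat,
    (forall k m, (k <= m)%N -> `|u m - u k| <= 2^-1 ^+ k) ->
    exists l : V, u n @[n --> \oo] --> l) ->
  forall F : set_system V, ProperFilter F -> cauchy F -> cvg F.
Proof.
move=> rapid F FF /cauchyP Fc.
have e_gt0 k : 0 < 2^-1 ^+ k :> R by rewrite exprn_gt0.
have [x Fx] := choice (fun k => Fc _ (e_gt0 k.+1)).
(* A point common to the balls of index at most k: for [k <= m] both [u k] and [u m] then lie in the
   ball around [x k], whose diameter is at most 2^-k. *)
have FB k : F [set y | forall j, (j <= k)%N -> ball (x j) (2^-1 ^+ j.+1) y].
  elim: k => [|k ih].
    by apply: filterS (Fx 0) => y ? j; rewrite leqn0 => /eqP ->.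
  apply: filterS (filterI ih (Fx k.+1)) => y [y1 y2] j.
  by rewrite leq_eqVlt => /predU1P[->//|]; exact: y1.
have [u uB] := choice (fun k => filter_ex (FB k)).
have split2 k : 2^-1 ^+ k = 2^-1 ^+ k.+1 + 2^-1 ^+ k.+1 :> R.
  by rewrite exprSr; exact: splitr.
have [|l ul] := rapid u.
  move=> k m km; have := ball_triangle (ball_sym (uB k k (leqnn _))) (uB m k km).
  by rewrite -split2 -ball_normE/= distrC => /ltW.
apply/cvg_ex; exists l; apply/cvgrPdist_lt => e e0.
have [k ke] : exists k, 2^-1 ^+ k < e / 2 :> R.
  by apply: exprn_small; rewrite ?divr_gt0// invr_ge0 ler0n/= invf_lt1// ltr1n.
move/cvgrPdist_lt : ul => /(_ (e / 2)) []; first by rewrite divr_gt0.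
move=> N _ /(_ (maxn N k) (leq_maxl _ _)) lu.
apply: filterS (Fx k) => y xy.
have := ball_triangle (ball_sym (uB (maxn N k) k (leq_maxr _ _))) xy.
rewrite -split2 -ball_normE/= => uy.
rewrite -(subrKA (u (maxn N k))) (le_lt_trans (ler_normD _ _))//.
by rewrite (splitr e) ltrD// (lt_trans uy).
Qed.

Lemma nneseries_geometric (R : realType) (a q : R) : 0 <= q < 1 ->
  (\sum_(0 <= k <oo) (a * q ^+ k)%:E)%E = (a / (1 - q))%:E.
Proof.
move=> /andP[q0 q1]; apply/cvg_lim => //.
rewrite (_ : (fun _ => _) = EFin \o series (geometric a q)).
  by apply: cvg_EFin; [exact: nearW|apply: cvg_geometric_series; rewrite ger0_norm].
by apply/funext => n; rewrite /series /= sumEFin.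
Qed.

(** The series of increments converges absolutely and telescopes to [a n - a 0]. *)
Lemma cvgn_of_summable_increments (R : realType) (a : R^nat) :
  (\sum_(0 <= k <oo) `|a k.+1 - a k|%:E < +oo)%E -> cvgn a.
Proof.
move=> aoo.
have : cvgn (series (telescope a)).
  apply: (@normed_cvg R R^o); apply: nondecreasing_is_cvgn.
    by apply/nondecreasing_seqP => n; rewrite /normed_series_of/series/=
      big_nat_recr//= lerDl.
  exists (fine (\sum_(0 <= k <oo) `|a k.+1 - a k|%:E)%E) => _ [n _ <-] /=.
  rewrite -lee_fin fineK; last first.
    by rewrite ge0_fin_numE// nneseries_ge0// => k _ _; rewrite lee_fin.
  by rewrite -sumEFin; apply: nneseries_lim_ge => k _ _; rewrite lee_fin.
move=> cs; rewrite (_ : a = (fun n => a 0%N + series (telescope a) n)).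
  by apply: is_cvgD => //; exact: is_cvg_cst.
by apply/funext => n; rewrite telescopeK /= addrC subrK.
Qed.

(** Every tail contains an index beyond [k], so its infimum is at most [c]. This is applied to the
    bound given by Fatou's lemma. *)
Lemma limn_einf_le (R : realType) (u : (\bar R)^nat) (c : \bar R) k :
  (forall n, (k <= n)%N -> (u n <= c)%E) -> (limn_einf u <= c)%E.
Proof.
move=> uc; rewrite limn_einf_lim; apply: lime_le; first exact: is_cvg_einfs.
apply: nearW => n; apply: le_trans (uc (maxn n k) (leq_maxr _ _)).
by apply: ereal_inf_lbound; exists (maxn n k) => //=; exact: leq_maxl.
Qed.

(** * Limits of rapid sequences in L^1 *)

Section rapid_cvg_L1.
Context d (T : measurableType d) (R : realType).
Variable mu : {measure set T -> \bar R}.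
Local Open Scope ereal_scope.

(** The argument of Riesz and Fischer: the sum [G] of the absolute increments has integral at most
    2, hence is finite almost everywhere, and where it is finite the sequence converges. *)
Lemma rapid_cvg_L1 (g : (T -> R)^nat) :
  (forall k, mu.-integrable setT (EFin \o g k)) ->
  (forall k m, (k <= m)%N ->
     \int[mu]_x `|g m x - g k x|%:E <= (2^-1 ^+ k)%:E) ->
  exists2 f, mu.-integrable setT (EFin \o f) &
    forall k, \int[mu]_x `|f x - g k x|%:E <= (2^-1 ^+ k)%:E.
Proof.
move=> ig dg.
have mg k : measurable_fun setT (g k).
  by apply/measurable_EFinP/(measurable_int mu).
have mdg k m : measurable_fun setT (fun x => `|g m x - g k x|%:E).
  by apply/measurable_EFinP; apply: measurableT_comp => //; exact: measurable_funB.
pose G x := \sum_(0 <= k <oo) `|g k.+1 x - g k x|%:E.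
have G0 x : 0 <= G x by apply: nneseries_ge0 => k _ _; rewrite lee_fin.
have iG : mu.-integrable setT G.
  apply/integrableP; split.
    by apply: ge0_emeasurable_sum => // k x _ _; rewrite lee_fin.
  under eq_integral do rewrite gee0_abs//.
  rewrite integral_nneseries//; apply: (@le_lt_trans _ _ (1 / (1 - 2^-1))%:E).
    rewrite -nneseries_geometric; last by rewrite invr_ge0 ler0n invf_lt1 ?ltr1n.
    apply: lee_nneseries => [k _ _|k _]; first exact: integral_ge0.
    by rewrite mul1r dg.
  exact: ltry.
(* The limsup is everywhere defined and measurable; it is the limit a.e. *)
pose f x := fine (limn_esup (fun n => (g n x)%:E)).
have mf : measurable_fun setT f.
  apply: measurableT_comp; first exact: measurable_realfun.fine_measurable.
  apply: measurable_realfun.measurable_fun_limn_esup => n.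
  exact/measurable_EFinP.
have gf : {ae mu, forall x, g n x @[n --> \oo] --> f x}.
  apply: filterS (integrable_ae measurableT iG) => x /(_ I) Gx.
  have gx : cvgn (g ^~ x).
    by apply: cvgn_of_summable_increments; move: Gx; rewrite ge0_fin_numE.
  have : (g n x)%:E @[n --> \oo] --> (limn (g ^~ x))%:E.
    by apply: cvg_EFin => //; exact: nearW.
  by rewrite /f => /cvg_limn_einf_sup[_ ->].
(* Fatou's lemma in m with k fixed: almost everywhere |f - g k| is the lower limit of |g m - g k|,
   whose integrals are at most 2^-k once [k <= m]. *)
have fg k : \int[mu]_x `|f x - g k x|%:E <= (2^-1 ^+ k)%:E.
  rewrite (ge0_ae_eq_integral
    (g := fun x => limn_einf (fun m => `|g m x - g k x|%:E)))//.
  - apply: le_trans (fatou _ _ _ _) _ => //; apply: (@limn_einf_le _ _ _ k).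
    exact: dg.
  - by apply/measurable_EFinP; apply: measurableT_comp => //; exact: measurable_funB.
  - apply: measurableT_comp => //; apply: measurable_fun_limn_esup => n.
    exact: measurableT_comp.
  - move=> x _; rewrite limn_einf_lim; apply: lime_ge; first exact: is_cvg_einfs.
    by apply: nearW => n; apply: le_ereal_inf_tmp => _ [m _ <-]; rewrite lee_fin.
  - apply: filterS gf => x gx _.
    have : `|g n x - g k x|%:E @[n --> \oo] --> `|f x - g k x|%:E.
      apply: cvg_EFin; first exact: nearW.
      by apply: cvg_norm; apply: cvgB => //; exact: cvg_cst.
    by move=> /cvg_limn_einf_sup[->].
exists f => //.
have ifg : mu.-integrable setT (EFin \o (fun x => f x - g 0%N x)%R).
  apply/integrableP; split; last exact: le_lt_trans (fg 0%N) (ltry _).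
  by apply/measurable_EFinP; exact: measurable_funB.
have := integrableD measurableT ifg (ig 0%N).
by apply: eq_integrable => // x _; rewrite /= -EFinD subrK.
Qed.
End rapid_cvg_L1.

(** * Functions of L^1 with finite dual variation *)

Section dual_variation.
Context d (T : measurableType d) (R : realType).
Variable mu : {measure set T -> \bar R}.
Context (J : Type) (D : set J) (h : J -> T -> R).

(** The fractional variation with its tests div^alpha phi replaced by an abstract family [h]. The
    functional analysis relies only on the tests being measurable, bounded, nonempty and closed
    under negation. *)
Definition dual_variation (f : T -> R) : \bar R :=
  ereal_sup [set (\int[mu]_x (f x * h i x)%:E)%E | i in D].

(* Convertible to [BV_frac n alpha] when [h] is [frac_div alpha] and [D] is
   [frac_test]. *)
Definition dualBV : Type :=
  {f : LspaceType1 mu | (dual_variation f < +oo)%E}.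

Definition dualBV_fun (u : dualBV) : T -> R := sval u.

(** Membership for functions instead of classes, so that pointwise sums and multiples can be treated
    before passing to the quotient. *)
Definition dualBV_pred (f : T -> R) :=
  mu.-integrable setT (EFin \o f) /\ (dual_variation f < +oo)%E.

Hypotheses (D0 : D !=set0)
  (mh : forall i, D i -> measurable_fun setT (h i))
  (bh : forall i, D i -> exists C : R, forall x, `|h i x| <= C)
  (hN : forall i, D i -> exists2 j, D j & h j = \- h i).

Local Notation L1 f := (mu.-integrable setT (EFin \o (f : T -> R))).

Lemma L1_measurable (f : T -> R) : L1 f -> measurable_fun setT f.
Proof. by move=> f1; apply/measurable_EFinP/(measurable_int mu). Qed.

Lemma L1D (f g : T -> R) : L1 f -> L1 g -> L1 (fun x => f x + g x).
Proof.
move=> f1 g1; have := integrableD measurableT f1 g1.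
by apply: eq_integrable => // x _; rewrite /= EFinD.
Qed.

Lemma L1Z a (f : T -> R) : L1 f -> L1 (fun x => a * f x).
Proof.
move=> f1; have := integrableZl measurableT a f1.
by apply: eq_integrable => // x _; rewrite /= EFinM.
Qed.

Lemma L1B (f g : T -> R) : L1 f -> L1 g -> L1 (fun x => f x - g x).
Proof.
move=> f1 g1; have := L1D f1 (L1Z (-1) g1).
by apply: eq_integrable => // x _; rewrite /= mulN1r.
Qed.

Lemma L1_mulr_test i (f : T -> R) : D i -> L1 f -> L1 (fun x => f x * h i x).
Proof.
move=> Di f1; have [C hC] := bh Di.
have hbd : [bounded h i x | x in [set: T]].
  exists C; split; first exact: num_real.
  by move=> M CM x _ /=; exact: le_trans (hC x) (ltW CM).
have := integrableMl measurableT f1 (mh Di) hbd.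
by apply: eq_integrable => // x _; rewrite /= EFinM.
Qed.

(** Makes the variation independent of the representative of a class. *)
Lemma ae_eq_dual_variation (f g : T -> R) : L1 f -> L1 g -> f = g %[ae mu] ->
  dual_variation f = dual_variation g.
Proof.
move=> f1 g1 fg; rewrite /dual_variation; congr ereal_sup.
apply: eq_imagel => i Di; apply: ae_eq_integral => //.
- exact: measurable_int (L1_mulr_test Di f1).
- exact: measurable_int (L1_mulr_test Di g1).
- by apply: filterS fg => x fgx _; rewrite fgx.
Qed.

Lemma dual_variation_ge (f : T -> R) i : D i ->
  (\int[mu]_x (f x * h i x)%:E <= dual_variation f)%E.
Proof. by move=> Di; apply: ereal_sup_ubound; exists i. Qed.

Lemma dual_variation_leP (f : T -> R) c :
  (forall i, D i -> \int[mu]_x (f x * h i x)%:E <= c)%E ->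
  (dual_variation f <= c)%E.
Proof. by move=> fc; apply: ge_ereal_sup => _ [i Di <-]; exact: fc. Qed.

Lemma integral_test_opp (f : T -> R) i : D i -> L1 f ->
  exists2 j, D j &
    (\int[mu]_x (f x * h j x)%:E = - \int[mu]_x (f x * h i x)%:E)%E.
Proof.
move=> Di f1; have [j Dj hj] := hN Di; exists j => //.
rewrite -[RHS]mulN1e -EFinN -(integralZl measurableT (L1_mulr_test Di f1)).
by apply: eq_integral => x _; rewrite hj /= -EFinM mulN1r mulrN.
Qed.

(** Of a test and its negative, one has a nonnegative pairing with [f]. *)
Lemma dual_variation_ge0 (f : T -> R) : L1 f -> (0 <= dual_variation f)%E.
Proof.
move=> f1; have [i Di] := D0; have [j Dj fj] := integral_test_opp Di f1.
have [fi0|/ltW fi0] := leP 0%E (\int[mu]_x (f x * h i x)%:E)%E.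
  exact: le_trans fi0 (dual_variation_ge _ Di).
by apply: le_trans (dual_variation_ge _ Dj); rewrite fj oppe_ge0.
Qed.

Lemma dual_variationD (f g : T -> R) : L1 f -> L1 g ->
  (dual_variation (fun x => f x + g x)%R <= dual_variation f + dual_variation g)%E.
Proof.
move=> f1 g1; apply: dual_variation_leP => i Di.
under eq_integral do rewrite mulrDl EFinD.
rewrite integralD//; [|exact: L1_mulr_test..].
by apply: leeD; exact: dual_variation_ge.
Qed.

Lemma dual_variationZ a (f : T -> R) : L1 f ->
  (dual_variation (fun x => a * f x)%R <= `|a|%:E * dual_variation f)%E.
Proof.
move=> f1; apply: dual_variation_leP => i Di.
under eq_integral do rewrite -mulrA EFinM.
rewrite integralZl//; last exact: L1_mulr_test.
have [a0|a0] := leP 0 a.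
  by rewrite ger0_norm// lee_wpmul2l// ?lee_fin//; exact: dual_variation_ge.
(* For negative [a] the sign is moved onto the opposite test. *)
have [j Dj fj] := integral_test_opp Di f1.
have -> : (a%:E * \int[mu]_x (f x * h i x)%:E =
    (- a)%:E * \int[mu]_x (f x * h j x)%:E)%E.
  by rewrite fj EFinN mulNe muleN oppeK.
rewrite ltr0_norm// lee_wpmul2l// ?lee_fin ?oppr_ge0 ?(ltW a0)//.
exact: dual_variation_ge.
Qed.


(** The measurable function is sent to its class; finiteness of the L^1 norm and of the variation
    passes from [f] to the chosen representative, which agrees with it almost everywhere. *)
Lemma dualBVP (f : T -> R) : dualBV_pred f ->
  exists u : dualBV, dualBV_fun u = f %[ae mu].
Proof.
move=> [f1 fV].
have mf : f \in @mfun _ _ T (measurableTypeR R).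
  by rewrite inE/=; exact: L1_measurable.
pose F : {mfun T >-> measurableTypeR R} :=
  @mfun_Sub _ _ T (measurableTypeR R) f mf.
pose F' : {mfun_ mu, T >-> measurableTypeR R} := (\pi F)%qT.
have F'f : (F' : T -> R) = f %[ae mu].
  have : repr F' == F %[mod {mfun_ mu, T >-> measurableTypeR R}]%qT by rewrite reprK.
  by rewrite eqmodE => /asboolP.
have mF' : measurable_fun setT (F' : T -> R).
  exact: (measurable_funPT (repr F')).
have F'1 : L1 F'.
  apply/integrableP; split; first exact/measurable_EFinP.
  have /integrableP[_] := f1; apply: le_lt_trans.
  rewrite le_eqVlt; apply/orP; left; apply/eqP; apply: ae_eq_integral => //.
  - by apply/measurableT_comp => //; exact/measurable_EFinP.
  - by apply/measurableT_comp => //; exact: measurable_int f1.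
  - by apply: filterS F'f => x /= Fx _; rewrite Fx.
have finF' : finite_norm mu 1 F'.
  by rewrite /finite_norm Lnorm1; have /integrableP[] := F'1.
pose c := isFinLebesgue.Axioms_ T R mu 1 (lexx _) F' finF'.
pose F1 : LspaceType1 mu := LebesgueSpace.Pack (LebesgueSpace.Class c).
have F1V : (dual_variation F1 < +oo)%E.
  by rewrite (ae_eq_dual_variation (g := f)).
by exists (exist _ F1 F1V).
Qed.

Lemma dualBV_funP (u : dualBV) : dualBV_pred (dualBV_fun u).
Proof.
case: u => [u uV]; split => //=.
have uf := @Lebesgue_finite _ _ _ _ _ _ u.
apply/integrableP; split; last by move: uf; rewrite /finite_norm Lnorm1.
by apply/measurable_EFinP; exact: (measurable_funPT (repr (u : {mfun_ mu, T >-> _}))).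
Qed.

(** Almost everywhere equality is the relation of the quotient, and the finiteness proofs are
    boolean, hence irrelevant. The algebraic laws thereby reduce to pointwise identities. *)
Lemma dualBV_ext (u v : dualBV) : dualBV_fun u = dualBV_fun v %[ae mu] -> u = v.
Proof.
case: u v => [[u [[uf]]] uV] [[v [[vf]]] vV] uv; apply: val_inj => /=.
have e : u = v.
  rewrite -[u]reprK -[v]reprK; apply/eqP; rewrite eqmodE; exact/asboolP.
move: uf uV {uv}; by rewrite e => uf _; rewrite (bool_irrelevance uf vf).
Qed.

(** * The vector space of classes with finite variation *)

Lemma dualBV_predD (u v : dualBV) :
  dualBV_pred (fun x => dualBV_fun u x + dualBV_fun v x).
Proof.
have [[u1 uV] [v1 vV]] := (dualBV_funP u, dualBV_funP v).
split; first exact: L1D.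
by rewrite (le_lt_trans (dual_variationD u1 v1))// lte_add_pinfty.
Qed.

Lemma dualBV_predZ (a : R) (u : dualBV) :
  dualBV_pred (fun x => a * dualBV_fun u x).
Proof.
have [u1 uV] := dualBV_funP u; split; first exact: L1Z.
rewrite (le_lt_trans (dual_variationZ a u1))//.
by rewrite lte_mul_pinfty ?lee_fin.
Qed.

Lemma dualBV_pred0 : dualBV_pred (fun=> 0).
Proof.
split; first exact: (integrable0 mu).
rewrite (@le_lt_trans _ _ 0%E)//; apply: dual_variation_leP => i _.
by rewrite integral0_eq// => x _; rewrite mul0r.
Qed.

(** The operations choose some class of the pointwise result; they are used only through their
    almost everywhere values, recorded in the three lemmas after them. *)
Definition dualBV0 : dualBV := sval (cid (dualBVP dualBV_pred0)).
Definition dualBV_add (u v : dualBV) : dualBV :=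
  sval (cid (dualBVP (dualBV_predD u v))).
Definition dualBV_scale (a : R) (u : dualBV) : dualBV :=
  sval (cid (dualBVP (dualBV_predZ a u))).
Definition dualBV_opp (u : dualBV) : dualBV := dualBV_scale (-1) u.

Lemma dualBV0E : dualBV_fun dualBV0 = fun=> 0 %[ae mu].
Proof. by rewrite /dualBV0; case: cid. Qed.

Lemma dualBV_addE u v : dualBV_fun (dualBV_add u v) =
  (fun x => dualBV_fun u x + dualBV_fun v x) %[ae mu].
Proof. by rewrite /dualBV_add; case: cid. Qed.

Lemma dualBV_scaleE a u : dualBV_fun (dualBV_scale a u) =
  (fun x => a * dualBV_fun u x) %[ae mu].
Proof. by rewrite /dualBV_scale; case: cid. Qed.

Lemma dualBV_addA : associative dualBV_add.
Proof.
move=> u v w; apply: dualBV_ext.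
apply: filterS2 (filterI (dualBV_addE u (dualBV_add v w)) (dualBV_addE v w))
  (filterI (dualBV_addE (dualBV_add u v) w) (dualBV_addE u v)).
by move=> x [e1 e2] [e3 e4] _; rewrite e1// e2// e3// e4// addrA.
Qed.

Lemma dualBV_addC : commutative dualBV_add.
Proof.
move=> u v; apply: dualBV_ext.
apply: filterS2 (dualBV_addE u v) (dualBV_addE v u).
by move=> x e1 e2 _; rewrite e1// e2// addrC.
Qed.

Lemma dualBV_add0 : left_id dualBV0 dualBV_add.
Proof.
move=> u; apply: dualBV_ext.
apply: filterS2 (dualBV_addE dualBV0 u) dualBV0E.
by move=> x e1 e2 _; rewrite e1// e2// add0r.
Qed.

Lemma dualBV_addN : left_inverse dualBV0 dualBV_opp dualBV_add.
Proof.
move=> u; apply: dualBV_ext.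
apply: filterS3 (dualBV_addE (dualBV_opp u) u) dualBV0E (dualBV_scaleE (-1) u).
by move=> x e1 e2 e3 _; rewrite e1// e2// e3// mulN1r addNr.
Qed.

HB.instance Definition _ := gen_eqMixin dualBV.
HB.instance Definition _ := gen_choiceMixin dualBV.
HB.instance Definition _ := GRing.isZmodule.Build dualBV
  dualBV_addA dualBV_addC dualBV_add0 dualBV_addN.

Lemma dualBV_scaleA a b u :
  dualBV_scale a (dualBV_scale b u) = dualBV_scale (a * b) u.
Proof.
apply: dualBV_ext; apply: filterS3 (dualBV_scaleE a (dualBV_scale b u))
  (dualBV_scaleE b u) (dualBV_scaleE (a * b) u).
by move=> x e1 e2 e3 _; rewrite e1// e2// e3// mulrA.
Qed.

Lemma dualBV_scale1 : left_id 1 dualBV_scale.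
Proof.
move=> u; apply: dualBV_ext; apply: filterS (dualBV_scaleE 1 u).
by move=> x e1 _; rewrite e1// mul1r.
Qed.

Lemma dualBV_scaleDr : right_distributive dualBV_scale +%R.
Proof.
move=> a u v; apply: dualBV_ext.
apply: filterS2 (filterI (dualBV_scaleE a (u + v)) (dualBV_addE u v))
  (filterI (dualBV_addE (dualBV_scale a u) (dualBV_scale a v))
           (filterI (dualBV_scaleE a u) (dualBV_scaleE a v))).
by move=> x [e1 e2] [e3 [e4 e5]] _; rewrite e1// e2// e3// e4// e5// mulrDr.
Qed.

Lemma dualBV_scaleDl u : {morph dualBV_scale^~ u : a b / a + b}.
Proof.
move=> a b; apply: dualBV_ext.
apply: filterS2 (dualBV_scaleE (a + b) u)
  (filterI (dualBV_addE (dualBV_scale a u) (dualBV_scale b u))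
           (filterI (dualBV_scaleE a u) (dualBV_scaleE b u))).
by move=> x e1 [e3 [e4 e5]] _; rewrite e1// e3// e4// e5// mulrDl.
Qed.

HB.instance Definition _ := GRing.Zmodule_isLmodule.Build R dualBV
  dualBV_scaleA dualBV_scale1 dualBV_scaleDr dualBV_scaleDl.

(** * The norm *)

Definition BVenorm (f : T -> R) : \bar R :=
  ('N[mu]_1[EFin \o f] + dual_variation f)%E.

(** Here [fine] loses nothing, since both summands are finite on [dualBV], as [dualBV_normE]
    shows. *)
Definition dualBV_norm (u : dualBV) : R := fine (BVenorm (dualBV_fun u)).

Lemma ae_eq_BVenorm (f g : T -> R) : L1 f -> L1 g -> f = g %[ae mu] ->
  BVenorm f = BVenorm g.
Proof.
move=> f1 g1 fg; rewrite /BVenorm (ae_eq_dual_variation f1 g1 fg) !Lnorm1.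
congr (_ + _)%E; apply: ae_eq_integral => //.
- by apply/measurableT_comp => //; exact: measurable_int f1.
- by apply/measurableT_comp => //; exact: measurable_int g1.
- by apply: filterS fg => x /= fgx _; rewrite fgx.
Qed.

Lemma BVenorm_ge0 (f : T -> R) : L1 f -> (0 <= BVenorm f)%E.
Proof. by move=> f1; rewrite adde_ge0 ?Lnorm_ge0 ?dual_variation_ge0. Qed.

Lemma dualBV_normE (u : dualBV) : (dualBV_norm u)%:E = BVenorm (dualBV_fun u).
Proof.
have [u1 uV] := dualBV_funP u; rewrite fineK// ge0_fin_numE ?BVenorm_ge0//.
by rewrite lte_add_pinfty// Lnorm1; have /integrableP[] := u1.
Qed.

Lemma dualBV_ler_normD (u v : dualBV) :
  dualBV_norm (u + v) <= dualBV_norm u + dualBV_norm v.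
Proof.
have [[u1 _] [v1 _]] := (dualBV_funP u, dualBV_funP v).
rewrite -lee_fin EFinD !dualBV_normE.
rewrite (ae_eq_BVenorm _ _ (dualBV_addE u v)); last 2 first.
- by have [] := dualBV_funP (dualBV_add u v).
- exact: L1D.
rewrite /BVenorm addeACA; apply: leeD; last exact: dual_variationD.
exact: (eminkowski mu (L1_measurable u1) (L1_measurable v1) (lexx 1%E)).
Qed.

Lemma dualBV_ler_normZ a (u : dualBV) :
  dualBV_norm (a *: u) <= `|a| * dualBV_norm u.
Proof.
have [u1 uV] := dualBV_funP u.
rewrite -lee_fin EFinM !dualBV_normE.
rewrite (ae_eq_BVenorm _ _ (dualBV_scaleE a u)); last 2 first.
- by have [] := dualBV_funP (dualBV_scale a u).
- exact: L1Z.
rewrite /BVenorm muleDr//; last first.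
  by rewrite ge0_adde_def// inE ?Lnorm_ge0 ?dual_variation_ge0.
apply: leeD; last exact: dual_variationZ.
rewrite !Lnorm1 -ge0_integralZl//; last first.
  by apply/measurableT_comp => //; exact: measurable_int u1.
by under eq_integral do rewrite /= normrM EFinM.
Qed.

(** The missing inequality is [dualBV_ler_normZ] for the scalar [a^-1] and the vector [a *: u]. *)
Lemma dualBV_normZ a (u : dualBV) : dualBV_norm (a *: u) = `|a| * dualBV_norm u.
Proof.
have [->|a0] := eqVneq a 0.
  apply/eqP; rewrite eq_le dualBV_ler_normZ normr0 mul0r -lee_fin dualBV_normE.
  by apply: BVenorm_ge0; have [] := dualBV_funP (0 *: u).
apply/eqP; rewrite eq_le dualBV_ler_normZ/=.
have := dualBV_ler_normZ a^-1 (a *: u).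
by rewrite scalerA mulVf// scale1r normfV ler_pdivlMl// normr_gt0.
Qed.

(** Both summands are nonnegative, so the L^1 norm vanishes by itself. *)
Lemma dualBV_norm_eq0 (u : dualBV) : dualBV_norm u = 0 -> u = 0.
Proof.
move=> u0; have := dualBV_normE u; rewrite u0 => /esym/eqP.
have [u1 _] := dualBV_funP u.
rewrite padde_eq0 ?Lnorm_ge0 ?dual_variation_ge0// => /andP[/eqP {}u0 _].
apply: dualBV_ext.
have : EFin \o dualBV_fun u = cst 0%E %[ae mu].
  by apply: Lnorm_eq0_eq0 u0 => //; exact: measurable_int u1.
by apply: filterS2 dualBV0E => x e0 /(_ I)[e1] _; rewrite e1 e0.
Qed.

HB.instance Definition _ := Lmodule_isNormed.Build R dualBV
  dualBV_ler_normD dualBV_normZ dualBV_norm_eq0.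

Lemma dualBV_subE (u v : dualBV) : dualBV_fun (u - v) =
  (fun x => dualBV_fun u x - dualBV_fun v x) %[ae mu].
Proof.
apply: filterS2 (dualBV_addE u (- v)) (dualBV_scaleE (-1) v).
by move=> x e1 e2 _; rewrite e1// e2// mulN1r.
Qed.

Lemma dualBV_normB (u v : dualBV) : `|u - v|%:E =
  BVenorm (fun x => dualBV_fun u x - dualBV_fun v x).
Proof.
transitivity (BVenorm (dualBV_fun (u - v))); first exact: dualBV_normE.
apply: ae_eq_BVenorm (dualBV_subE u v).
- by have [] := dualBV_funP (u - v).
- by have [[u1 _] [v1 _]] := (dualBV_funP u, dualBV_funP v); exact: L1B.
Qed.

(** For a rapid sequence the L^1 limit [f] is within 2^-k of [u k] both in L^1 and in variation, so
    the full norm of the difference is at most twice 2^-k. *)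
Lemma dualBV_complete (F : set_system dualBV) :
  ProperFilter F -> cauchy F -> cvg F.
Proof.
apply: rapid_complete => u du.
have u1 k : L1 (dualBV_fun (u k)) by have [] := dualBV_funP (u k).
have duE k m : (k <= m)%N ->
    (BVenorm (fun x => dualBV_fun (u m) x - dualBV_fun (u k) x)%R
      <= (2^-1 ^+ k)%:E)%E.
  by move=> km; rewrite -dualBV_normB lee_fin du.
have [k m km|f f1 fu] := rapid_cvg_L1 u1.
  have := duE _ _ km; rewrite /BVenorm Lnorm1; apply: le_trans.
  by rewrite leeDl// dual_variation_ge0//; exact: L1B.
(* Lower semicontinuity, test by test: the pairing with [f - u k] is split at a late [u m]. The part
   [u m - u k] contributes at most 2^-k by the variation bound, the part [f - u m] at most C 2^-m,
   which is below any given [e]. *)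
have fuV k : (dual_variation (fun x => f x - dualBV_fun (u k) x)%R
    <= (2^-1 ^+ k)%:E)%E.
  apply: dual_variation_leP => i Di; have [C' hC'] := bh Di.
  (* The absolute value keeps the bound nonnegative even over an empty space. *)
  pose C := `|C'|; have hC x : `|h i x| <= C by apply: le_trans (hC' x) (ler_norm _).
  have C0 : 0 <= C by exact: normr_ge0.
  apply/lee_addgt0Pr => e e0.
  (* The denominator is [C + 1] because [C] may vanish. *)
  have [N Ne] : exists N, 2^-1 ^+ N < e / (C + 1) :> R.
    apply: exprn_small; last by rewrite divr_gt0// ltr_wpDl.
    by rewrite invr_ge0 ler0n/= invf_lt1// ltr1n.
  pose m := maxn N k.
  have -> : (\int[mu]_x ((f x - dualBV_fun (u k) x) * h i x)%:E =
     \int[mu]_x ((f x - dualBV_fun (u m) x) * h i x)%:E +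
     \int[mu]_x ((dualBV_fun (u m) x - dualBV_fun (u k) x) * h i x)%:E)%E.
    rewrite -integralD//; [|by apply: L1_mulr_test => //; exact: L1B..].
    by apply: eq_integral => x _; rewrite -EFinD -mulrDl addrA subrK.
  rewrite addeC; apply: leeD.
    apply: le_trans (dual_variation_ge _ Di) _.
    apply: le_trans (duE k m (leq_maxr _ _)).
    by rewrite /BVenorm leeDr// Lnorm_ge0.
  have fm1 := L1B f1 (u1 m).
  apply: (@le_trans _ _ (\int[mu]_x (C%:E * `|f x - dualBV_fun (u m) x|%:E))%E).
    apply: le_integral => //; first exact: L1_mulr_test.
      by apply: integrableZl => //; exact: integrable_abse fm1.
    move=> x _; rewrite -EFinM lee_fin (le_trans (ler_norm _))// normrM mulrC.
    by rewrite ler_wpM2r.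
  rewrite ge0_integralZl//; last first.
    exact: measurable_int (integrable_abse fm1).
  rewrite (@le_trans _ _ (C%:E * (2^-1 ^+ m)%:E)%E)//.
    by rewrite lee_wpmul2l.
  rewrite -EFinM lee_fin.
  have mN : 2^-1 ^+ m <= 2^-1 ^+ N :> R.
    by rewrite ler_wiXn2l ?leq_maxl// invf_le1// ler1n.
  apply: (@le_trans _ _ ((C + 1) * (e / (C + 1)))).
    apply: ler_pM => //; first by rewrite lerDl.
    exact: le_trans mN (ltW Ne).
  by rewrite mulrC divfK// gt_eqF// ltr_wpDl.
have fBV : dualBV_pred f.
  split => //.
  (* Finite variation of [f] comes from that of [f - u 0] and of [u 0]. *)
  have -> : f = (fun x => (f x - dualBV_fun (u 0%N) x) + dualBV_fun (u 0%N) x).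
    by apply/funext => x; rewrite subrK.
  rewrite (le_lt_trans (dual_variationD _ _))//; first exact: L1B.
  rewrite lte_add_pinfty//; first exact: le_lt_trans (fuV 0%N) (ltry _).
  by have [] := dualBV_funP (u 0%N).
have [l lf] := dualBVP fBV; exists l.
have lu k : `|l - u k| <= 2^-1 ^+ k + 2^-1 ^+ k.
  rewrite -lee_fin EFinD dualBV_normB.
  rewrite (@ae_eq_BVenorm _ (fun x => f x - dualBV_fun (u k) x)); last 3 first.
  - by apply: L1B => //; have [] := dualBV_funP l.
  - exact: L1B.
  - by apply: filterS lf => x lx _; rewrite lx.
  by rewrite /BVenorm Lnorm1; apply: leeD; [exact: fu|exact: fuV].
apply/cvgrPdist_le => e e0.
have [N Ne] : exists N, 2^-1 ^+ N < e / 2 :> R.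
  apply: exprn_small; last by rewrite divr_gt0.
  by rewrite invr_ge0 ler0n/= invf_lt1// ltr1n.
exists N => // k /= Nk; apply: le_trans (lu k) _; rewrite [e]splitr.
have kN : 2^-1 ^+ k <= 2^-1 ^+ N :> R.
  by rewrite ler_wiXn2l// invf_le1// ler1n.
by rewrite lerD// ltW// (le_lt_trans kN).
Qed.

HB.instance Definition _ := Uniform_isComplete.Build dualBV dualBV_complete.

(** The three clauses fix which Banach space is meant: its operations are those of functions up to
    null sets, its norm is the L^1 norm plus the variation. *)
Theorem dualBV_banach : exists c : CompleteNormedModule R dualBV,
  let V : completeNormedModType R := CompleteNormedModule.Pack c in
  [/\ forall u v : V, dualBV_fun (u + v) =
        (fun x => dualBV_fun u x + dualBV_fun v x) %[ae mu],
      forall (a : R) (u : V), dualBV_fun (a *: u) =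
        (fun x => a * dualBV_fun u x) %[ae mu] &
      forall u : V, `|u|%:E = BVenorm (dualBV_fun u)].
Proof.
exists (CompleteNormedModule.class (dualBV : completeNormedModType R)).
by split; [exact: dualBV_addE|exact: dualBV_scaleE|exact: dualBV_normE].
Qed.

End dual_variation.

(** * Measure theory of R^n *)

Section rV_borel.
Context (R : realType) (n : nat).
Implicit Types x y : 'rV[R]_n.

(** The sup norm is a maximum starting at 0, so in dimension 0 the coordinates alone do not force
    [0 <= c]. *)
Lemma rV_norm_leP x (c : R) : 0 <= c ->
  `|x| <= c <-> forall i, `|x ord0 i| <= c.
Proof.
move=> c0; rewrite /Num.norm/= mx_normrE; split=> [/bigmax_leP[_ xc] i|xc].
  exact: (xc (ord0, i)).
by apply/bigmax_leP; split=> // -[i j] _ /=; rewrite (ord1 i); exact: xc.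
Qed.

Lemma rV_coord_norm_le x i : `|x ord0 i| <= `|x|.
Proof. exact: (rV_norm_leP x (normr_ge0 x)).1. Qed.

Lemma measurable_rV_box (P : 'I_n -> set R) : (forall i, measurable (P i)) ->
  measurable [set y : 'rV[R]_n | forall i, P i (y ord0 i)].
Proof.
move=> mP; rewrite (_ : mkset _ =
    \bigcap_(i in [set: 'I_n]) ((fun y : 'rV[R]_n => y ord0 i) @^-1` P i)).
  apply: fin_bigcap_measurable; first exact: finite_finset.
  move=> i _; rewrite -[X in measurable X]setTI.
  exact: (measurable_rV_coord i measurableT (mP i)).
by apply/seteqP; split=> [y yP i _|y yP i]; [exact: yP|exact: (yP i I)].
Qed.

(** An open set is the union of the boxes with rational centre and radius 1/(k+1) that it contains;
    there are countably many, each measurable for the product sigma-algebra. *)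
Lemma open_measurable_rV (U : set 'rV[R]_n) : open U -> measurable U.
Proof.
move=> oU.
pose box (p : 'rV[rat]_n * nat) : set 'rV[R]_n :=
  [set y | forall i, ball (ratr (p.1 ord0 i) : R) p.2.+1%:R^-1 (y ord0 i)].
have mbox p : measurable (box p).
  apply: (@measurable_rV_box
    (fun i => ball (ratr (p.1 ord0 i) : R) p.2.+1%:R^-1)) => i.
  exact: measurable_ball.
pose F p := if `[< box p `<=` U >] then box p else set0.
have -> : U = \bigcup_p F p.
  apply/seteqP; split=> [x Ux|x [p _]]; last first.
    by rewrite /F; case: asboolP => // + bx; exact.
  have /nbhs_ballP[e /= e0 xeU] : nbhs x U by apply: open_nbhs_nbhs; split.
  (* With 2/(k+1) at most [e], a box of radius 1/(k+1) containing x stays in the ball of radius [e]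
     around x. *)
  pose k := Num.truncn (2 / e).
  have ke : k.+1%:R^-1 + k.+1%:R^-1 <= e.
    rewrite -mulr2n -(mulr_natl _ 2) ler_pdivrMr ?ltr0n// mulrC -ler_pdivrMr//.
    by apply: ltW; rewrite truncnS_gt.
  have q_ex (i : 'I_n) : exists q : rat, ball (ratr q : R) k.+1%:R^-1 (x ord0 i).
    have [|q] := @rat_in_itvoo R (x ord0 i - k.+1%:R^-1) (x ord0 i + k.+1%:R^-1).
      by rewrite ltrBlDr -addrA ltrDl addr_gt0// invr_gt0 ltr0n.
    rewrite in_itv/= => /andP[q1 q2]; exists q.
    by rewrite /ball/= ltr_norml ltrBrDl q1 ltrBlDl q2.
  have [q xq] := choice q_ex.
  exists (\row_i q i, k) => //.
  have qx : box (\row_i q i, k) x by move=> i /=; rewrite mxE.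
  rewrite /F; case: asboolP => // -[] y qy.
  apply: xeU; split=> // i j; rewrite (ord1 i).
  apply: (@le_ball _ _ _ (k.+1%:R^-1 + k.+1%:R^-1)) => //.
  exact: ball_triangle (ball_sym (qx j)) (qy j).
apply: countable_bigcupT_measurable => [|p].
  exact: countableP.
by rewrite /F; case: ifP.
Qed.

Lemma continuous_measurable_rV (f : 'rV[R]_n -> R) : continuous f ->
  measurable_fun setT f.
Proof.
move=> /continuousP cf; apply: (measurability _ (RGenOpens.measurableE R)).
move=> _ [_ [a [b ->]] <-]; rewrite setTI; apply: open_measurable_rV.
by apply: cf; exact: interval_open.
Qed.

End rV_borel.

Section rV_box.
Context (R : realType).

(** Induction along the recursive measure: [rV_cons] pulls a box back to the product of its first
    side and a box of one dimension less. In dimension 0 the Dirac mass gives 1. *)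
Lemma lebesgue_rV_prod n (P : 'I_n -> set R) (r : \bar R) :
  (forall i, measurable (P i)) ->
  (forall i, lebesgue_measure (P i) = r) -> 
  lebesgue_rV R n [set y : 'rV[R]_n | forall i, P i (y ord0 i)] = (r ^+ n)%E.
Proof.
elim: n P => [|n ih] P mP Pr.
  rewrite /= diracE mem_set ?expe0//; by case.
have pre : @rV_cons R n @^-1` [set y : 'rV[R]_n.+1 | forall i, P i (y ord0 i)] =
    P ord0 `*` [set y : 'rV[R]_n | forall i : 'I_n, P (lift ord0 i) (y ord0 i)].
  have consE (p : measurableTypeR R * 'rV[R]_n) :
      rV_cons p ord0 ord0 = p.1 /\ forall i, rV_cons p ord0 (lift ord0 i) = p.2 ord0 i.
    have := rV_consK p; case: p => a y [e1 e2]; split=> // i.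
    rewrite -[in RHS]e2 [RHS]mxE; congr (fun_of_matrix _ _ _); exact: val_inj.
  apply/seteqP; split=> [p /= pP|p /= [aP yP] i].
    by have [e1 e2] := consE p; split=> [|i]; rewrite -?e1 -?e2.
  have [e1 e2] := consE p.
  by case: (unliftP ord0 i) => [j|] ->; rewrite ?e1 ?e2.
rewrite -[LHS]/((@lebesgue_measure R \x lebesgue_rV R n)%E 
  (@rV_cons R n @^-1` [set y : 'rV[R]_n.+1 | forall i, P i (y ord0 i)])) pre.
have mP' (i : 'I_n) : measurable (P (lift ord0 i)) by exact: mP.
have mbox := measurable_rV_box mP'.
rewrite product_measure1E; [|exact: mP|exact: mbox].
by rewrite expeS; congr (_ * _)%E; [exact: Pr|exact: (ih _ mP')].
Qed.

Lemma lebesgue_rV_ball n (x : 'rV[R]_n) (r : R) : 0 <= r ->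
  lebesgue_rV R n [set y | `|y - x| <= r] = ((2 * r) ^+ n)%:E.
Proof.
move=> r0.
have -> : [set y | `|y - x| <= r] = [set y : 'rV[R]_n |
    forall i, [set a | x ord0 i - r <= a <= x ord0 i + r] (y ord0 i)].
  apply/seteqP; split=> y /=.
    by move=> /(rV_norm_leP _ r0) yx i; have := yx i; rewrite !mxE ler_distl.
  move=> yx; apply/(rV_norm_leP _ r0) => i; have := yx i.
  by rewrite !mxE ler_distl.
have mI (i : 'I_n) : [set a | x ord0 i - r <= a <= x ord0 i + r] =
    `[x ord0 i - r, x ord0 i + r]%classic.
  by apply/seteqP; split=> a; rewrite /= in_itv.
rewrite EFin_expe; apply: (@lebesgue_rV_prod n
  (fun i => [set a | x ord0 i - r <= a <= x ord0 i + r])) => i; rewrite mI//.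
rewrite lebesgue_measure_itv/= lte_fin.
have [r_gt0|r_le0] := ltP; first by congr EFin; ring.
have -> : r = 0 by lra.
by rewrite mulr0.
Qed.

End rV_box.

(** * Bounds on the fractional divergence *)

Section singular_integral.
Context (R : realType) (n : nat).
Implicit Types x y : 'rV[R]_n.

(* The radii drop out of the integral of this majorant, which is a / (1 - q). *)
Let ball_series (a q : R) (rho : nat -> R) x y : \bar R :=
  (\sum_(0 <= k <oo)
    (a * q ^+ k / (2 * rho k) ^+ n * \1_[set z : 'rV[R]_n | `|z - x| <= rho k] y)%:E)%E.

Lemma measurable_norm_ball x (r : R) : 0 <= r ->
  measurable [set y : 'rV[R]_n | `|y - x| <= r].
Proof.
move=> r0; have -> : [set y | `|y - x| <= r] = [set y : 'rV[R]_n |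
    forall i, [set a | `|a - x ord0 i| <= r] (y ord0 i)].
  apply/seteqP; split=> y /=.
    by move=> /(rV_norm_leP _ r0) yx i; have := yx i; rewrite !mxE.
  by move=> yx; apply/(rV_norm_leP _ r0) => i; have := yx i; rewrite !mxE.
apply: (@measurable_rV_box _ _ (fun i => [set a | `|a - x ord0 i| <= r])) => i.
have -> : [set a | `|a - x ord0 i| <= r] = `[x ord0 i - r, x ord0 i + r]%classic.
  by apply/seteqP; split=> a; rewrite /= in_itv/= ler_distl.
exact: measurable_itv.
Qed.

Section ball_series.
Context (a q : R) (rho : nat -> R) (x : 'rV[R]_n).
Hypotheses (a0 : 0 <= a) (q01 : 0 <= q < 1) (rho0 : forall k, 0 < rho k).

Let c k := a * q ^+ k / (2 * rho k) ^+ n.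
Let c0 k : 0 <= c k.
Proof.
have /andP[q0 _] := q01.
by rewrite divr_ge0 ?mulr_ge0 ?exprn_ge0// mulr_ge0// ltW.
Qed.

Let mterm k : measurable_fun setT
  (fun y => (c k * \1_[set z : 'rV[R]_n | `|z - x| <= rho k] y)%:E).
Proof.
apply/measurable_EFinP; apply: measurable_funM => //.
by apply: measurable_indic; apply: measurable_norm_ball; exact: ltW.
Qed.

Let term_ge0 k y : (0 <= (c k * \1_[set z : 'rV[R]_n | `|z - x| <= rho k] y)%:E)%E.
Proof. by rewrite lee_fin mulr_ge0. Qed.

Lemma measurable_ball_series : measurable_fun setT (ball_series a q rho x).
Proof.
by apply: ge0_emeasurable_sum => [k y _ _|k _]; [exact: term_ge0|exact: mterm].
Qed.

Lemma ball_series_ge0 y : (0 <= ball_series a q rho x y)%E.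
Proof. by apply: nneseries_ge0 => k _ _; exact: term_ge0. Qed.

Lemma integral_ball_series :
  (\int[lebesgue_rV R n]_y ball_series a q rho x y = (a / (1 - q))%:E)%E.
Proof.
rewrite integral_nneseries; first last.
- by move=> *; exact: term_ge0.
- exact: mterm.
- exact: measurableT.
rewrite -nneseries_geometric//.
apply: eq_eseriesr => k _.
have mB := measurable_norm_ball x (ltW (rho0 k)).
under eq_integral do rewrite EFinM.
rewrite ge0_integralZl; first last.
- by rewrite lee_fin; exact: c0.
- by move=> y _; rewrite lee_fin.
- by apply/measurable_EFinP; exact: measurable_indic.
- exact: measurableT.
rewrite (integral_indic _ measurableT mB) setIT.
apply: etrans (congr1 (fun e => (c k)%:E * e)%E
  (lebesgue_rV_ball x (ltW (rho0 k)))) _.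
by rewrite -EFinM /c divfK// expf_neq0// mulf_neq0// gt_eqF.
Qed.

(** A nonnegative series dominates each of its terms, so whole balls can stand in for dyadic
    shells. *)
Lemma le_ball_series k y : `|y - x| <= rho k ->
  ((a * q ^+ k / (2 * rho k) ^+ n)%:E <= ball_series a q rho x y)%E.
Proof.
move=> yk; rewrite /ball_series.
apply: (le_trans _ (nneseries_lim_ge k.+1 _)) => //=; last first.
  by move=> i _ _; exact: term_ge0.
rewrite big_nat_recr//= indicE mem_set// mulr1 leeDr//.
by apply: sume_ge0 => i _; exact: term_ge0.
Qed.

End ball_series.

(** The least exponent whose power is below [r] is positive because [r <= 1]; [k] is its
    predecessor. *)
Lemma dyadic_shell (r : R) : 0 < r <= 1 ->
  exists k, 2^-1 ^+ k.+1 < r <= 2^-1 ^+ k.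
Proof.
move=> /andP[r0 r1].
have hex : exists k, 2^-1 ^+ k < r.
  by apply: exprn_small => //; rewrite invr_ge0 ler0n/= invf_lt1// ltr1n.
case: (ex_minnP hex) => -[|k] rk kmin; first by move: rk; rewrite expr0 ltNge r1.
exists k; rewrite rk/= leNgt; apply/negP => /kmin; by rewrite ltnn.
Qed.

Lemma powR_expn (q s : R) k : 0 <= q -> (q ^+ k) `^ s = (q `^ s) ^+ k.
Proof. by move=> q0; rewrite -!powR_mulrn ?powR_ge0// -!powRrM mulrC. Qed.

(** The first bound is used in the unit ball around x and the second outside it; each is majorized
    by a [ball_series] of ratio 2^-s or 2^-t. The constant is uniform in [x] and [F]. *)
Lemma singular_integral_bound (s t c1 c2 : R) : 0 < s -> 0 < t ->
  0 <= c1 -> 0 <= c2 -> exists C : R, forall x (F : 'rV[R]_n -> R),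
    measurable_fun setT F -> F x = 0 ->
    (forall y, y != x -> `|F y| <= c1 * (`|y - x| `^ s / `|y - x| ^+ n)) ->
    (forall y, y != x -> `|F y| <= c2 * (`|y - x| `^ (- t) / `|y - x| ^+ n)) ->
    (\int[lebesgue_rV R n]_y `|F y|%:E <= C%:E)%E.
Proof.
move=> s0 t0 c10 c20.
pose q1 : R := 2^-1 `^ s; pose q2 : R := 2^-1 `^ t.
pose rho1 k : R := 2^-1 ^+ k; pose rho2 k : R := 2 ^+ k.+1.
have h01 : 0 <= (2^-1 : R) < 1 by rewrite invr_ge0 ler0n/= invf_lt1// ltr1n.
have qlt (e : R) : 0 < e -> 0 <= (2^-1 : R) `^ e < 1.
  move=> e0; have e1 : 1 `^ e = 1 :> R by rewrite powR1.
  rewrite powR_ge0/= -[ltRHS]e1.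
  by have /andP[? ?] := h01; apply: gt0_ltr_powR; rewrite ?nnegrE.
(* On a shell of outer radius rho the inner radius is rho/2, and 1/(rho/2)^n = 4^n/(2 rho)^n, where
   (2 rho)^n is the volume of the ball. *)
exists (c1 * 4 ^+ n / (1 - q1) + c2 * 4 ^+ n / (1 - q2)) => x F mF Fx F1 F2.
have a10 : 0 <= c1 * 4 ^+ n by rewrite mulr_ge0// exprn_ge0.
have a20 : 0 <= c2 * 4 ^+ n by rewrite mulr_ge0// exprn_ge0.
have rho10 k : 0 < rho1 k by rewrite exprn_gt0// invr_gt0.
have rho20 k : 0 < rho2 k by rewrite exprn_gt0.
have q101 := qlt _ s0; have q201 := qlt _ t0.
rewrite EFinD -(integral_ball_series x a10 q101 rho10).
rewrite -(integral_ball_series x a20 q201 rho20).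
rewrite -ge0_integralD//; first last.
- exact: measurable_ball_series.
- by move=> y _; exact: ball_series_ge0.
- exact: measurable_ball_series.
- by move=> y _; exact: ball_series_ge0.
apply: ge0_le_integral => //.
- by apply/measurable_EFinP; exact: measurableT_comp.
- by apply: emeasurable_funD; exact: measurable_ball_series.
move=> y _; have [->|yx] := eqVneq y x.
  by rewrite Fx normr0 adde_ge0// ball_series_ge0.
have r0 : 0 < `|y - x| by rewrite normr_gt0 subr_eq0.
have rn0 : 0 < `|y - x| ^+ n by rewrite exprn_gt0.
have [r1|r1] := leP `|y - x| 1.
  have [k /andP[kr rk]] : exists k, 2^-1 ^+ k.+1 < `|y - x| <= 2^-1 ^+ k.
    by apply: dyadic_shell; rewrite r0.
  apply: le_trans (leeDl _ (ball_series_ge0 _ _ _ _ _)) => //.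
  apply: le_trans (le_ball_series _ _ _ rk) => //.
  rewrite lee_fin (le_trans (F1 _ yx))// -!mulrA ler_wpM2l//.
  rewrite mulrCA; apply: ler_pM => //; rewrite ?powR_ge0 ?invr_ge0 ?(ltW rn0)//.
    rewrite -powR_expn; last by have /andP[] := h01.
    by apply: ge0_ler_powR; rewrite ?nnegrE ?exprn_ge0 ?(ltW s0)//; have /andP[] := h01.
  rewrite -[leRHS]/(4 ^+ n / (2 * 2^-1 ^+ k) ^+ n) -expr_div_n -exprVn.
  apply: lerXn2r; rewrite ?nnegrE ?invr_ge0 ?divr_ge0 ?mulr_ge0 ?exprn_ge0//.
  have -> : 4 / (2 * 2^-1 ^+ k) = (2^-1 ^+ k.+1)^-1 :> R.
    by rewrite exprS; field; rewrite expf_neq0.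
  by rewrite lef_pV2 ?posrE ?exprn_gt0 ?invr_gt0// ltW.
(* Outside the unit ball the shells are those of the inverse distance. *)
have [k /andP[kr rk]] : exists k, 2^-1 ^+ k.+1 < `|y - x|^-1 <= 2^-1 ^+ k.
  by apply: dyadic_shell; rewrite invr_gt0 r0/= invf_le1// ltW.
have rk' : `|y - x| <= rho2 k.
  rewrite /rho2 -[leRHS]invrK -exprVn -[leLHS]invrK lef_pV2 ?posrE ?exprn_gt0 ?invr_gt0//.
  exact: ltW.
apply: le_trans (leeDr _ (ball_series_ge0 _ _ _ _ _)) => //.
apply: le_trans (le_ball_series _ _ _ rk') => //.
rewrite lee_fin (le_trans (F2 _ yx))// -!mulrA ler_wpM2l//.
rewrite mulrCA; apply: ler_pM => //; rewrite ?powR_ge0 ?invr_ge0 ?(ltW rn0)//.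
  rewrite -powR_expn ?invr_ge0//.
  have -> : `|y - x| `^ (- t) = `|y - x|^-1 `^ t.
    by rewrite -powR_inv1 ?(ltW r0)// -powRrM mulN1r.
  by apply: ge0_ler_powR; rewrite ?nnegrE ?exprn_ge0 ?(ltW t0) ?invr_ge0.
rewrite -[leRHS]/(4 ^+ n / (2 * 2 ^+ k.+1) ^+ n) -expr_div_n -exprVn.
apply: lerXn2r; rewrite ?nnegrE ?invr_ge0 ?divr_ge0 ?mulr_ge0 ?exprn_ge0//.
apply: le_trans rk _; rewrite exprS exprVn le_eqVlt; apply/orP; left; apply/eqP.
by field; rewrite expf_neq0.
Qed.

End singular_integral.

Section frac_div_regularity.
Context (R : realType) (n : nat).
Implicit Types (x y u w : 'rV[R]_n) (alpha : R) (phi : 'rV[R]_n -> 'rV[R]_n).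

Lemma dotv_le u w : `|dotv u w| <= n%:R * (`|u| * `|w|).
Proof.
apply: le_trans (ler_norm_sum _ _ _) _.
rewrite -[n in n%:R]card_ord mulr_natl -sumr_const; apply: ler_sum => i _.
by rewrite normrM ler_pM// rV_coord_norm_le.
Qed.

Lemma norm_le_enorm u : `|u| <= enorm u.
Proof.
apply/rV_norm_leP => [|i]; first exact: sqrtr_ge0.
rewrite -sqrtr_sqr ler_sqrt; last first.
  by apply: sumr_ge0 => j _; rewrite -expr2 sqr_ge0.
rewrite /dotv (bigD1 i)//= -expr2 lerDl.
by apply: sumr_ge0 => j _; rewrite -expr2 sqr_ge0.
Qed.

Lemma dot0v w : dotv (0 : 'rV[R]_n) w = 0.
Proof. by rewrite /dotv big1// => i _; rewrite mxE mul0r. Qed.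

(** The integrand of [frac_div], named so that its joint measurability and its integrability in [y]
    can be stated. *)
Definition frac_kernel (alpha : R) (phi : 'rV[R]_n -> 'rV[R]_n) x y : R :=
  dotv (y - x) (phi y - phi x) / enorm (y - x) `^ (n%:R + alpha + 1).

(* [enorm] occurs only in the denominator, where the sup norm bounds it below. *)
Lemma frac_kernel_le alpha phi x y : 0 < alpha -> y != x ->
  `|frac_kernel alpha phi x y| <=
  n%:R * `|phi y - phi x| * (`|y - x| `^ (- alpha) / `|y - x| ^+ n).
Proof.
move=> alpha0 yx; have r0 : 0 < `|y - x| by rewrite normr_gt0 subr_eq0.
have e0 : 0 < n%:R + alpha + 1 by rewrite addr_gt0// ltr_wpDl.
rewrite /frac_kernel normrM normfV (ger0_norm (powR_ge0 _ _)).
apply: (@le_trans _ _ (n%:R * (`|y - x| * `|phi y - phi x|) /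
    `|y - x| `^ (n%:R + alpha + 1))).
  apply: ler_pM; rewrite ?normr_ge0 ?invr_ge0 ?powR_ge0 ?dotv_le//.
  have er : 0 < enorm (y - x) := lt_le_trans r0 (norm_le_enorm _).
  rewrite lef_pV2 ?posrE ?powR_gt0//.
  by apply: ge0_ler_powR; rewrite ?nnegrE ?norm_le_enorm ?(ltW e0) ?(ltW er).
have nz : `|y - x| != 0 by rewrite gt_eqF.
(* The exponent splits into n, [alpha] and 1; the last factor cancels the |y - x| of the scalar
   product. *)
rewrite !powRD ?nz ?implybT// powRr1 ?(ltW r0)// powR_mulrn ?(ltW r0)// powRN.
rewrite le_eqVlt; apply/orP; left; apply/eqP; field.
by rewrite expf_neq0// nz gt_eqF// powR_gt0.
Qed.

Lemma measurable_frac_kernel alpha phi : continuous phi ->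
  measurable_fun setT
    (fun p : 'rV[R]_n * 'rV[R]_n => frac_kernel alpha phi p.1 p.2).
Proof.
move=> cphi; rewrite /frac_kernel; under eq_fun do rewrite -powRN.
have mphi i : measurable_fun setT (fun x => phi x ord0 i).
  apply: continuous_measurable_rV => x.
  apply: (@continuous_comp _ _ _ phi (fun M : 'rV[R]_n => M ord0 i)).
    exact: cphi.
  exact: coord_continuous.
have mcoord i : measurable_fun setT (fun x : 'rV[R]_n => x ord0 i : R).
  exact: measurable_rV_coord.
have mD (f : 'rV[R]_n -> R) : measurable_fun setT f ->
    measurable_fun setT (fun p : 'rV[R]_n * 'rV[R]_n => f p.2 - f p.1).
  move=> mf; apply: measurable_funB.
    exact: (measurableT_comp mf measurable_snd).
  exact: (measurableT_comp mf measurable_fst).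
have e1 i : measurable_fun setT (fun p : 'rV[R]_n * 'rV[R]_n => (p.2 - p.1) ord0 i).
  by under eq_fun do rewrite !mxE; exact: (mD _ (mcoord i)).
have e2 i : measurable_fun setT
    (fun p : 'rV[R]_n * 'rV[R]_n => (phi p.2 - phi p.1) ord0 i).
  by under eq_fun do rewrite !mxE; exact: (mD _ (mphi i)).
apply: measurable_funM.
  by apply: measurable_sum => i; apply: measurable_funM.
apply: (measurableT_comp (measurable_powR _)).
apply: (@measurableT_comp _ _ _ _ _ _ (Num.sqrt : R -> R) _
  (fun p : 'rV[R]_n * 'rV[R]_n => dotv (p.2 - p.1) (p.2 - p.1))).
  exact: continuous_measurable_fun (@sqrt_continuous R).
by apply: measurable_sum => i; apply: measurable_funM.
Qed.

(** The integral is the difference of those of the positive and negative parts, each measurable in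
    [x] by Tonelli's theorem and joint measurability of the kernel. *)
Lemma measurable_frac_div alpha phi : continuous phi ->
  measurable_fun setT (frac_div alpha phi).
Proof.
move=> cphi; apply: measurable_funM => //.
have /measurable_EFinP mk := measurable_frac_kernel alpha cphi.
rewrite /Rintegral; apply: (measurableT_comp (f := fine)).
  exact: fine_measurable.
under eq_fun do rewrite integralE.
apply: emeasurable_funB.
  have := measurable_fun_fubini_tonelli_F (m2 := lebesgue_rV R n) _
    (measurable_funepos mk) (fun p => funepos_ge0 _ p).
  by apply: eq_measurable_fun => x _; rewrite /fubini_F; apply: eq_integral => y _;
  rewrite unlock.
have := measurable_fun_fubini_tonelli_F (m2 := lebesgue_rV R n) _
  (measurable_funeneg mk) (fun p => funeneg_ge0 _ p).
by apply: eq_measurable_fun => x _; rewrite /fubini_F; apply: eq_integral => y _;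
  rewrite unlock.
Qed.

(** The Lipschitz bound gains a factor |y - x| and gives the exponent [1 - alpha] near [x]; the
    bound [2 * M] on increments gives the exponent [- alpha] at infinity. *)
Lemma frac_kernel_L1 alpha (M L : R) phi : 0 < alpha -> alpha < 1 ->
  continuous phi -> (forall x, `|phi x| <= M) ->
  (forall x y, `|phi y - phi x| <= L * `|y - x|) ->
  exists C : R, forall x,
    (lebesgue_rV R n).-integrable setT (EFin \o frac_kernel alpha phi x) /\
    (\int[lebesgue_rV R n]_y `|frac_kernel alpha phi x y|%:E <= C%:E)%E.
Proof.
move=> alpha0 alpha1 cphi phiM phiL.
have M0 : 0 <= M := le_trans (normr_ge0 _) (phiM 0).
(* In dimension 0 the Lipschitz bound does not determine the sign of [L]. *)
have L0 : 0 <= `|L| := normr_ge0 L.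
have s0 : 0 < 1 - alpha by rewrite subr_gt0.
have nL0 : 0 <= n%:R * `|L| by rewrite mulr_ge0.
have nM0 : 0 <= n%:R * (2 * M) by rewrite !mulr_ge0.
have [C hC] := singular_integral_bound n s0 alpha0 nL0 nM0.
exists C => x.
have mk : measurable_fun setT (frac_kernel alpha phi x).
  have := measurableT_comp (measurable_frac_kernel alpha cphi) (measurable_pair1 x).
  by apply: eq_measurable_fun.
have kC : (\int[lebesgue_rV R n]_y `|frac_kernel alpha phi x y|%:E <= C%:E)%E.
  apply: (hC x) => [||y yx|y yx].
  - exact: mk.
  - by rewrite /frac_kernel subrr dot0v mul0r.
  - apply: le_trans (frac_kernel_le _ alpha0 yx) _.
    have r0 : 0 < `|y - x| by rewrite normr_gt0 subr_eq0.
    rewrite -!mulrA ler_wpM2l// powRD; last by rewrite gt_eqF// implybT.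
    rewrite powRr1 ?(ltW r0)// -[X in _ <= _ * X]mulrA [leRHS]mulrA.
    rewrite ler_wpM2r ?divr_ge0 ?powR_ge0 ?exprn_ge0//.
    by rewrite (le_trans (phiL _ _))// ler_wpM2r// ler_norm.
  - apply: le_trans (frac_kernel_le _ alpha0 yx) _.
    rewrite ler_wpM2r ?divr_ge0 ?powR_ge0 ?exprn_ge0// ler_wpM2l//.
    by rewrite (le_trans (ler_normB _ _))// mulr2n mulrDl !mul1r lerD.
split=> //; apply/integrableP; split; last exact: le_lt_trans kC (ltry _).
exact/measurable_EFinP.
Qed.

Lemma bounded_frac_div alpha (M L : R) phi : 0 < alpha -> alpha < 1 ->
  continuous phi -> (forall x, `|phi x| <= M) ->
  (forall x y, `|phi y - phi x| <= L * `|y - x|) ->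
  exists C : R, forall x, `|frac_div alpha phi x| <= C.
Proof.
move=> alpha0 alpha1 cphi phiM phiL.
have [C hC] := frac_kernel_L1 alpha0 alpha1 cphi phiM phiL.
exists (`|mu_frac n alpha| * C) => x; have [ik kC] := hC x.
rewrite /frac_div normrM ler_wpM2l//.
apply: le_trans (le_normr_Rintegral measurableT ik) _.
rewrite -lee_fin fineK//; exact: (integrable_fin_num measurableT (integrable_abse ik)).
Qed.

(** Integrability of the kernel lets the factor -1 leave the integral. This yields the symmetry of
    the family of tests. *)
Lemma frac_divN alpha (M L : R) phi : 0 < alpha -> alpha < 1 ->
  continuous phi -> (forall x, `|phi x| <= M) ->
  (forall x y, `|phi y - phi x| <= L * `|y - x|) ->
  frac_div alpha (- phi) = \- frac_div alpha phi.
Proof.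
move=> alpha0 alpha1 cphi phiM phiL.
have [C hC] := frac_kernel_L1 alpha0 alpha1 cphi phiM phiL.
apply/funext => x; have [ik _] := hC x.
rewrite /frac_div /= -mulrN; congr (_ * _).
rewrite -mulN1r -(RintegralZl _ measurableT ik); apply: eq_Rintegral => y _.
rewrite mulN1r /frac_kernel -mulNr; congr (_ / _).
rewrite /dotv -sumrN; apply: eq_bigr => i _.
by rewrite -mulrN !fctE !mxE opprD.
Qed.

End frac_div_regularity.

(** * Regularity of the test fields *)

Section smooth.
Context (R : realType).

Lemma smoothN (V W : normedModType R) (f : V -> W) : smooth f -> smooth (- f).
Proof.
move=> sf k; have {sf} := sf k; elim: k f => [|k ih] f /=.
  by move=> cf x; apply: cvgN; exact: cf.
move=> [df Df]; split=> [x|v]; first exact: differentiableN.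
have -> : 'D_v (- f) = - 'D_v f.
  by apply/funext => x; rewrite deriveN//; exact: diff_derivable.
exact: ih.
Qed.

Lemma smooth0 (V W : normedModType R) : smooth (0 : V -> W).
Proof.
move=> k; elim: k => [|k ih] /=; first by move=> x; exact: cvg_cst.
split=> [x|v]; first exact: differentiable_cst.
have -> // : 'D_v (0 : V -> W) = 0.
by apply/funext => x; exact: derive_cst.
Qed.

(** The set [K] is kept separate from [g] so that one compact set, the support of a field, also
    serves for its derivatives. *)
Lemma compact_support_bounded (V W : normedModType R) (g : V -> W) (K : set V) :
  continuous g -> compact K -> (forall x, ~ K x -> g x = 0) ->
  exists M, forall x, `|g x| <= M.
Proof.
move=> cg cK g0.
have /compact_bounded[M [_ gM]] : compact (g @` K).
  by apply: continuous_compact => //; exact: continuous_subspaceT.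
(* Every number above [M] bounds the image of [K]; the maximum with 0 covers the other points. *)
exists (Num.max (M + 1) 0) => x.
have [Kx|nKx] := pselect (K x); last by rewrite g0// normr0 le_max lexx orbT.
by rewrite le_max (gM (M + 1)) ?ltrDl//; exists x.
Qed.

Lemma derive_out_support (V W : normedModType R) (f : V -> W) v x :
  ~ closure [set x | f x != 0] x -> 'D_v f x = 0.
Proof.
move=> nKx; rewrite -(derive_cst (0 : W) x v); apply: near_eq_derive.
have : nbhs x (~` closure [set x | f x != 0]).
  by apply: open_nbhs_nbhs; split=> //; apply: closed_openC; exact: closed_closure.
apply: filterS => y; apply: contra_notP => /eqP fy.
exact: subset_closure.
Qed.

Section rV.
Context (n : nat).
Implicit Types (x y v : 'rV[R]_n) (phi : 'rV[R]_n -> 'rV[R]_n).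

(** The differential is linear, so bounds on the partial derivatives control all directions at
    once. *)
Lemma derive_le_coord phi (M : 'I_n -> R) x v : differentiable phi x ->
  (forall i, `|'D_('e_i) phi x| <= M i) ->
  `|'D_v phi x| <= (\sum_i M i) * `|v|.
Proof.
move=> dphi hM; rewrite deriveE// [v in 'd _ _ v]row_sum_delta linear_sum.
apply: le_trans (ler_norm_sum _ _ _) _; rewrite mulr_suml; apply: ler_sum => i _.
rewrite linearZ/= normrZ mulrC -deriveE//.
by apply: ler_pM => //; exact: rV_coord_norm_le.
Qed.

(** The difference quotient in [t] is the [j]-th coordinate of that of [phi] in direction [v]. The
    scalar form serves the mean value theorem. *)
Lemma is_derive_line phi x v j (t : R) : differentiable phi (x + t *: v) ->
  is_derive t 1 (fun s : R => phi (x + s *: v) ord0 j)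
    ('D_v phi (x + t *: v) ord0 j).
Proof.
move=> /(@diff_derivable _ _ _ _ _ v) dphi.
have cv : h^-1 *: (((fun s : R => phi (x + s *: v) ord0 j) \o shift t) (h *: 1)
    - phi (x + t *: v) ord0 j) @[h --> 0^'] --> 'D_v phi (x + t *: v) ord0 j.
  have := cvg_comp _ _ dphi (@coord_continuous R 1 n ord0 j _).
  apply: cvg_trans; apply: near_eq_cvg; apply: nearW => h /=.
  rewrite !mxE; congr (_ * (phi _ _ _ - _)).
  rewrite /shift/= (_ : h%:A = h :> R); last exact: mulr1.
  by rewrite scalerDl addrCA.
by apply: DeriveDef; [apply/cvg_ex; eexists; exact: cv|exact: (cvg_lim _ cv)].
Qed.

(** The mean value theorem on the segment from [x] to [y], one coordinate at a time; for the sup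
    norm this loses no constant. *)
Lemma lipschitz_of_derive_le phi (L : R) :
  (forall x, differentiable phi x) ->
  (forall x v, `|'D_v phi x| <= L * `|v|) ->
  forall x y, `|phi y - phi x| <= L * `|y - x|.
Proof.
move=> dphi hL x y; apply/rV_norm_leP => [|j].
  exact: le_trans (normr_ge0 _) (hL 0 _).
have [||c _] := @MVT_segment R (fun s : R => phi (x + s *: (y - x)) ord0 j)
   (fun t => 'D_(y - x) phi (x + t *: (y - x)) ord0 j) 0 1 ler01.
- by move=> t _; exact: is_derive_line.
- apply: derivable_within_continuous => t _; apply: ex_derive; exact: is_derive_line.
rewrite scale1r scale0r addr0 subr0 mulr1 [x + _]addrC subrK !mxE => ->.
exact: le_trans (rV_coord_norm_le _ _) (hL _ _).
Qed.

(** The partial derivatives are continuous and vanish off the compact support of [phi], hence are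
    bounded, which gives the Lipschitz constant. *)
Lemma frac_test_regular phi : frac_test phi -> exists M L : R,
  [/\ continuous phi, forall x, `|phi x| <= M &
      forall x y, `|phi y - phi x| <= L * `|y - x|].
Proof.
move=> [sphi cphi _].
have phi0 x : ~ closure [set x | phi x != 0] x -> phi x = 0.
  by apply: contra_notP => /eqP phix; exact: subset_closure.
have [M hM] := compact_support_bounded (sphi 0%N) cphi phi0.
have [dphi Dphi] := sphi 1%N.
have [m hm] := choice (fun i : 'I_n =>
  compact_support_bounded (Dphi 'e_i) cphi (@derive_out_support _ _ phi 'e_i)).
exists M, (\sum_i m i); split => //; first exact: (sphi 0%N).
apply: lipschitz_of_derive_le => // x v.
exact: derive_le_coord.
Qed.

Lemma frac_testN phi : frac_test phi -> frac_test (- phi).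
Proof.
move=> [sphi cphi nphi]; split; first exact: smoothN.
- rewrite /compactly_supported (_ : [set x | _] = [set x | phi x != 0])//.
  by apply/seteqP; split => x /=; rewrite oppr_eq0.
- rewrite (@eq_Lnorm _ _ _ _ _ _ (EFin \o enorm \o phi))// => x /=; congr EFin.
  rewrite /enorm /dotv; congr Num.sqrt; apply: eq_bigr => i _.
  by rewrite !mxE mulrNN.
Qed.

Lemma frac_test0 : @frac_test R n 0.
Proof.
split; first exact: smooth0.
- rewrite /compactly_supported (_ : [set x | _] = set0).
    by rewrite closure0; exact: compact0.
  by apply/seteqP; split => x //=; rewrite eqxx.
- rewrite (@eq_Lnorm _ _ _ _ _ _ (cst 0%E)) ?Lnorm0// => x /=; congr EFin.
  by rewrite /enorm /dotv big1 ?sqrtr0// => i _; rewrite !mxE mul0r.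
Qed.

End rV.
End smooth.

(** * The space of functions with finite fractional variation *)

Unset Implicit Arguments.

Theorem corollary3p4 (R : realType) (n : nat) (alpha : R)
    (n_ge1 : (1 <= n)%N) (alpha_gt0 : 0 < alpha) (alpha_lt1 : alpha < 1) :
  exists c : CompleteNormedModule R (@BV_frac R n alpha),
    let V : completeNormedModType R := CompleteNormedModule.Pack c in
    [/\ forall u v : V,
          BV_frac_fun (u + v) = (fun x => BV_frac_fun u x + BV_frac_fun v x)
          %[ae lebesgue_rV R n],
        forall (a : R) (u : V),
          BV_frac_fun (a *: u) = (fun x => a * BV_frac_fun u x)
          %[ae lebesgue_rV R n] &
        forall u : V, `|u|%:E = BV_frac_norm u].
Proof.
(* The space and its norm unfold to those of [dualBV], with the fields as indices and their
   fractional divergences as tests; the four hypotheses on the tests remain. *)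
apply: (@dualBV_banach _ _ _ (lebesgue_rV R n) _ (@frac_test R n)
  (@frac_div R n alpha)).
- by exists 0; exact: frac_test0.
- move=> phi /frac_test_regular[M [L [cphi _ _]]].
  exact: measurable_frac_div.
- move=> phi /frac_test_regular[M [L [cphi phiM phiL]]].
  exact: bounded_frac_div phiM phiL.
- move=> phi Tphi; have [M [L [cphi phiM phiL]]] := frac_test_regular Tphi.
  exists (- phi); first exact: frac_testN.
  exact: frac_divN phiM phiL.
Qed.
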